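(* Let $G$ be a commutative group, let $R$ be a $G$-graded ring, and let $M$ be a $G$-graded $R$-module. Suppose there exists an infinite subgroup $F\subseteq G$ such that, denoting by $\pi\colon G\twoheadrightarrow G/F$ the canonical projection, the canonical monomorphism of functors $h_{\pi}^M$ is an isomorphism. Then $h_{\psi}^M$ is an isomorphism for every epimorphism of commutative groups $\psi\colon G\twoheadrightarrow H$; in particular, $h_{0}^M$ is an isomorphism, where $0$ denotes the epimorphism $G\twoheadrightarrow 0$.
   Context: All groups and rings are commutative; groups are written additively. A $G$-graded ring is a ring $R$ with a family $(R_g)_{g\in G}$ of additive subgroups such that $R=\bigoplus_{g\in G}R_g$ and $R_gR_h\subseteq R_{g+h}$ for $g,h\in G$. A $G$-graded $R$-module is an $R$-module $M$ with a family $(M_g)_{g\in G}$ of additive subgroups such that $M=\bigoplus_{g\in G}M_g$ and $R_gM_h\subseteq M_{g+h}$ for $g,h\in G$. $\mathsf{GrMod}^G(R)$ is the category of $G$-graded $R$-modules whose morphisms are the $R$-linear maps $u\colon M\rightarrow N$ with $u(M_g)\subseteq N_g$ for all $g\in G$. For $g\in G$, $N(g)$ denotes the shift of $N$ by $g$: $N(g)_a=N_{a+g}$ for $a\in G$. Let $\psi\colon G\twoheadrightarrow H$ be an epimorphism of commutative groups. $\psi$-coarsening: $R_{[\psi]}$ is the $H$-graded ring with the same underlying ring as $R$ and with component $\bigoplus_{g\in\psi^{-1}(h)}R_g$ in degree $h\in H$; for a $G$-graded $R$-module $M$, $M_{[\psi]}$ is the $H$-graded $R_{[\psi]}$-module with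 the same underlying module and with component $\bigoplus_{g\in\psi^{-1}(h)}M_g$ in degree $h\in H$; on morphisms, $u_{[\psi]}$ has the same underlying map as $u$. Graded Hom: ${}^{G}\mathrm{Hom}_{R}(M,N)=\bigoplus_{g\in G}\mathrm{Hom}_{\mathsf{GrMod}^G(R)}(M,N(g))$, a $G$-graded $R$-module whose component of degree $g$ is $\mathrm{Hom}_{\mathsf{GrMod}^G(R)}(M,N(g))$; analogously for $H$ and $R_{[\psi]}$. For a $G$-graded $R$-module $N$, the monomorphisms of groups $\mathrm{Hom}_{\mathsf{GrMod}^G(R)}(M,N(g))\rightarrowtail\mathrm{Hom}_{\mathsf{GrMod}^H(R_{[\psi]})}(M_{[\psi]},N_{[\psi]}(\psi(g)))$, $u\mapsto u_{[\psi]}$, for $g\in G$ induce a monomorphism $h_{\psi}^M(N)\colon{}^{G}\mathrm{Hom}_{R}(M,N)_{[\psi]}\rightarrowtail{}^{H}\mathrm{Hom}_{R_{[\psi]}}(M_{[\psi]},N_{[\psi]})$ in $\mathsf{GrMod}^H(R_{[\psi]})$, natural in $N$. This defines the monomorphism of functors $h_\psi^M\colon{}^{G}\mathrm{Hom}_{R}(M,\bullet)_{[\psi]}\rightarrowtail{}^{H}\mathrm{Hom}_{R_{[\psi]}}(M_{[\psi]},\bullet_{[\psi]})$. *)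

(* Defs.v *)
From HB Require Import structures.
From mathcomp Require Import all_boot all_order all_algebra.
From mathcomp Require Import all_classical.

Set Implicit Arguments.
Unset Strict Implicit.
Unset Printing Implicit Defensive.

Import GRing.Theory.
Local Open Scope classical_set_scope.
Local Open Scope ring_scope.

Section FiniteSums.
Variables (G : choiceType) (V : zmodType).
Implicit Types f u : G -> V.

Definition fin_supp f : Prop := finite_set [set g | f g != 0].

Lemma fin_supp_sub f (s : seq G) : (forall g, g \notin s -> f g = 0) -> fin_supp f.
Proof.
move=> fs; apply: (@sub_finite_set _ _ [set` s]); last exact: finite_seq.
by move=> g /= fg; apply/negPn/negP => gs; rewrite fs ?eqxx in fg.
Qed.

Lemma fin_suppP f : fin_supp f ->
  exists2 s : seq G, uniq s & forall g, g \notin s -> f g = 0.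
Proof.
move=> ff; exists (finmap.enum_fset (fset_set [set g | f g != 0])); first exact: finmap.fset_uniq.
move=> g gs; apply/eqP/negPn/negP => h; move/negP: gs; apply.
by have := in_fset_set ff g; rewrite (mem_set (h : [set g | f g != 0] g)).
Qed.

Lemma fin_suppP2 f u : fin_supp f -> fin_supp u -> exists s : seq G,
  [/\ uniq s, forall g, g \notin s -> f g = 0 & forall g, g \notin s -> u g = 0].
Proof.
move=> /fin_suppP[s _ fs] /fin_suppP[t _ ut].
exists (undup (s ++ t)); split; first exact: undup_uniq.
  by move=> g; rewrite mem_undup mem_cat negb_or => /andP[/fs].
by move=> g; rewrite mem_undup mem_cat negb_or => /andP[_ /ut].
Qed.

Lemma fsum_seq (D : set G) f (s : seq G) :
  uniq s -> (forall g, g \notin s -> f g = 0) ->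
  \sum_(g \in D) f g = \sum_(g <- s | g \in D) f g.
Proof.
by move=> us fs; rewrite [RHS]bigfs ?set_mem_set // => g _; apply: fs.
Qed.

Lemma fsumT_seq f (s : seq G) :
  uniq s -> (forall g, g \notin s -> f g = 0) ->
  \sum_(g \in [set: G]) f g = \sum_(g <- s) f g.
Proof. by move=> us /fsum_seq ->//; apply: eq_bigl => g; rewrite in_setT. Qed.

Lemma fsumB (D : set G) f u : fin_supp f -> fin_supp u ->
  \sum_(g \in D) (f g - u g) = \sum_(g \in D) f g - \sum_(g \in D) u g.
Proof.
move=> ff fu; have [s [us fs us0]] := fin_suppP2 ff fu.
rewrite !(fsum_seq _ us) // ?sumrB // => g gs; by rewrite fs // us0 // subrr.
Qed.

Lemma fin_suppB f u : fin_supp f -> fin_supp u -> fin_supp (fun g => f g - u g).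
Proof.
move=> ff fu; have [s [us fs us0]] := fin_suppP2 ff fu.
by apply: (@fin_supp_sub _ s) => g gs; rewrite fs // us0 // subrr.
Qed.

Lemma fin_supp0 : fin_supp (fun=> 0).
Proof. exact: (@fin_supp_sub _ [::]). Qed.

Definition single (a : G) (x : V) (g : G) : V := if g == a then x else 0.

Lemma fin_supp_single a x : fin_supp (single a x).
Proof.
by apply: (@fin_supp_sub _ [:: a]) => g; rewrite inE /single => /negbTE ->.
Qed.

Lemma fsum_single (D : set G) a x : D a -> \sum_(g \in D) single a x g = x.
Proof.
move=> Da; rewrite (@fsum_seq _ _ [:: a]) //; last first.
  by move=> g; rewrite inE /single => /negbTE ->.
by rewrite big_cons big_nil mem_set // addr0 /single eqxx.
Qed.

Lemma sum_seq1 (t : seq G) f a : uniq t ->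
  \sum_(k <- t | k == a) f k = if a \in t then f a else 0.
Proof.
move=> ut; case: ifPn => [at_|/negP at_].
  by rewrite big_mkcond (bigD1_seq a) //= eqxx big1 ?addr0 // => k /negbTE ->.
by rewrite big_seq_cond big1 // => k /andP[kt /eqP ka]; case: at_; rewrite -ka.
Qed.

End FiniteSums.

Section DirectSums.
Variables (G : choiceType) (V : zmodType).
Implicit Types A : G -> zmodClosed V.

(* V is the internal direct sum of the subgroups A g.  The index set may be
   infinite: \sum_(g \in D) f g is the sum over the support of f in D, and
   would default to 0 if that were infinite, hence the fin_supp clauses. *)
Definition is_direct_sum A : Prop :=
  forall x : V, exists! f : G -> V,
    [/\ forall g, f g \in A g, fin_supp f & x = \sum_(g \in [set: G]) f g].

(* The subgroup \sum_(g in D) A g of V, which is the direct sum of the A g,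
   g in D, as soon as the family A is independent. *)
Definition family_sum A (D : set G) : {pred V} := fun x =>
  `[< exists f : G -> V,
        [/\ forall g, f g \in A g, fin_supp f & x = \sum_(g \in D) f g] >].

Lemma family_sumP A D x : reflect (exists f : G -> V,
    [/\ forall g, f g \in A g, fin_supp f & x = \sum_(g \in D) f g])
  (x \in family_sum A D).
Proof. exact: asboolP. Qed.

Lemma family_sum_zmod A D : zmod_closed (family_sum A D).
Proof.
split.
  apply/family_sumP; exists (fun=> 0); split=> [g||]; first exact: rpred0.
    exact: fin_supp0.
  by rewrite fsbig1.
move=> x y /family_sumP[f [fA ff ->]] /family_sumP[u [uA fu ->]].
apply/family_sumP; exists (fun g => f g - u g); split=> [g||].
- exact: rpredB.
- exact: fin_suppB.
- by rewrite fsumB.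
Qed.

HB.instance Definition _ A D :=
  GRing.isZmodClosed.Build V (family_sum A D) (family_sum_zmod A D).

Lemma family_sum_in A (D : set G) g x : D g -> x \in A g -> x \in family_sum A D.
Proof.
move=> Dg xA; apply/family_sumP; exists (single g x); split.
- by move=> a; rewrite /single; case: eqP => [->//|_]; apply: rpred0.
- exact: fin_supp_single.
- by rewrite fsum_single.
Qed.

End DirectSums.

Record grading (G : choiceType) (V : zmodType) := Grading {
  gr_comp :> G -> zmodClosed V;
  gr_direct : is_direct_sum gr_comp }.

Section Parts.
Variables (G : choiceType) (V : zmodType) (A : grading G V).

(* The homogeneous components of x. *)
Definition part (x : V) : G -> V := projT1 (cid (gr_direct A x)).

Lemma part_spec x : unique (fun f : G -> V =>
  [/\ forall g, f g \in A g, fin_supp f & x = \sum_(g \in [set: G]) f g])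
  (part x).
Proof. by rewrite /part; case: cid. Qed.

Lemma part_in x g : part x g \in A g.
Proof. by have [[+ _ _] _] := part_spec x; apply. Qed.

Lemma part_fin x : fin_supp (part x).
Proof. by have [[]] := part_spec x. Qed.

Lemma part_sum x : x = \sum_(g \in [set: G]) part x g.
Proof. by have [[]] := part_spec x. Qed.

Lemma part_uniq x f : (forall g, f g \in A g) -> fin_supp f ->
  x = \sum_(g \in [set: G]) f g -> part x = f.
Proof. by move=> fA ff xf; have [_] := part_spec x; apply. Qed.

Lemma partB x y : part (x - y) = (fun g => part x g - part y g).
Proof.
apply: part_uniq => [g||].
- by apply: rpredB; apply: part_in.
- by apply: fin_suppB; apply: part_fin.
- by rewrite fsumB; [rewrite -!part_sum|exact: part_fin|exact: part_fin].
Qed.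

Lemma part0 g : part 0 g = 0.
Proof.
by have /(congr1 (@^~ g)) := partB 0 0; rewrite subr0 /= => ->; rewrite subrr.
Qed.

Lemma partD x y g : part (x + y) g = part x g + part y g.
Proof.
have pN z : part (- z) g = - part z g.
  by have /(congr1 (@^~ g)) := partB 0 z; rewrite sub0r /= part0 sub0r.
by have /(congr1 (@^~ g)) := partB x (- y); rewrite opprK /= pN opprK.
Qed.

Lemma part_homog a x : x \in A a -> part x = single a x.
Proof.
move=> xA; apply: part_uniq.
- by move=> g; rewrite /single; case: eqP => [->//|_]; apply: rpred0.
- exact: fin_supp_single.
- by rewrite fsum_single.
Qed.

End Parts.

Section CoarsenGrading.
Variables (G H : choiceType) (psi : G -> H) (V : zmodType) (A : grading G V).

Definition coarse_comp (h : H) : zmodClosed V := family_sum A (psi @^-1` [set h]).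

Lemma coarse_compE h x :
  x \in coarse_comp h <-> forall g, psi g != h -> part A x g = 0.
Proof.
split=> [/family_sumP[f [fA ff ->]] g gh|x0].
  rewrite fsbig_mkcond (@part_uniq _ _ _ _ (patch (fun=> 0) (psi @^-1` [set h]) f)) //.
  - by rewrite /patch ifF //; apply/negbTE; rewrite notin_setE /=; apply/eqP.
  - by move=> a; rewrite /patch; case: ifP => // _; apply: rpred0.
  - have [s us fs] := fin_suppP ff.
    by apply: (@fin_supp_sub _ _ _ s) => a /fs; rewrite /patch => ->; rewrite if_same.
apply/family_sumP; exists (part A x); split; [exact: part_in|exact: part_fin|].
rewrite {1}(part_sum A x) [RHS]fsbig_mkcond; apply: eq_fsbigr => g _.
rewrite /patch; case: ifP => // /negbT; rewrite notin_setE /= => /eqP; exact: x0.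
Qed.

Lemma coarse_direct : is_direct_sum coarse_comp.
Proof.
move=> x; have [s us xs] := fin_suppP (part_fin A x).
have E h : \sum_(g \in psi @^-1` [set h]) part A x g =
           \sum_(g <- s | psi g == h) part A x g.
  by rewrite (fsum_seq _ us xs); apply: eq_bigl => g; apply/idP/eqP; rewrite inE.
exists (fun h => \sum_(g \in psi @^-1` [set h]) part A x g); split; first split.
- move=> h; apply/family_sumP; exists (part A x).
  by split=> //; [exact: part_in|exact: part_fin].
- apply: (@fin_supp_sub _ _ _ (map psi s)) => h hs; rewrite E big_seq_cond big1 //.
  by move=> g /andP[gs /eqP gh]; move/negP: hs; case; rewrite -gh; apply: map_f.
- rewrite {1}(part_sum A x) (fsumT_seq us xs).
  rewrite (@fsumT_seq _ _ _ (undup (map psi s))) ?undup_uniq //; last first.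
    move=> h; rewrite mem_undup => hs; rewrite E big_seq_cond big1 //.
    by move=> g /andP[gs /eqP gh]; move/negP: hs; case; rewrite -gh; apply: map_f.
  under [RHS]eq_bigr do rewrite E.
  rewrite (exchange_big_dep xpredT) //= big_seq [RHS]big_seq; apply: eq_bigr => g gs.
  under eq_bigl do rewrite eq_sym.
  by rewrite sum_seq1 ?undup_uniq // mem_undup map_f.
- move=> f [fA ff xf]; apply/funext => h.
  have fE k g : part A (f k) g = if psi g == k then part A (f k) g else 0.
    by case: eqP => // /eqP gk; have /coarse_compE -> := fA k.
  have [t ut ft] := fin_suppP ff.
  have pS g : part A x g = \sum_(k <- t) part A (f k) g.
    rewrite xf (fsumT_seq ut ft); elim: (t) => [|k r IH].
      by rewrite !big_nil part0.
    by rewrite !big_cons partD IH.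
  have pxf g : part A x g = part A (f (psi g)) g.
    rewrite pS; under eq_bigr do rewrite fE eq_sym.
    rewrite -big_mkcond sum_seq1 //; case: ifPn => // /ft ->.
    by rewrite part0.
  rewrite [RHS](part_sum A (f h)) [LHS]fsbig_mkcond; apply: eq_fsbigr => g _.
  rewrite /patch [RHS]fE; case: ifPn; first by rewrite inE /= => <-; rewrite eqxx pxf.
  by rewrite notin_setE /= => /eqP/negbTE ->.
Qed.

Definition coarsen_grading : grading H V := Grading coarse_direct.

Lemma coarse_in g x : x \in A g -> x \in coarse_comp (psi g).
Proof. exact: family_sum_in. Qed.

End CoarsenGrading.

(* Commutative rings are not required to be nontrivial (pz = possibly zero);
   1 has degree 0 automatically, the grading group being a group. *)
Record grRing (G : zmodType) (R : comPzRingType) := GrRing {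
  ring_grading :> grading G R;
  ring_gradedM : forall (g h : G) (a b : R),
    a \in ring_grading g -> b \in ring_grading h ->
    a * b \in ring_grading (g + h) }.

Record grMod (G : zmodType) (R : comPzRingType) (gR : grRing G R) := GrMod {
  mod_sort :> lmodType R;
  mod_grading : grading G mod_sort;
  mod_gradedZ : forall (g h : G) (a : R) (x : mod_sort),
    a \in gR g -> x \in mod_grading h -> a *: x \in mod_grading (g + h) }.

Definition homog G R (gR : grRing G R) (M : grMod gR) (g : G) : zmodClosed M :=
  mod_grading M g.

Record grMor G R (gR : grRing G R) (M N : grMod gR) := GrMor {
  mor_lin :> {linear M -> N};
  mor_homog : forall (g : G) (x : M), x \in homog M g -> mor_lin x \in homog N g }.

Section Category.
Variables (G : zmodType) (R : comPzRingType) (gR : grRing G R).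
Implicit Types M N P : grMod gR.

Lemma grMor_ext M N (u v : grMor M N) : u =1 v -> u = v.
Proof.
case: u v => [[f cf] hf] [[f' cf'] hf'] /= ff'.
have {ff'}ff' : f = f' by exact/funext.
case: _ / ff' in cf' hf' *.
case: cf cf' hf hf' => [[m1] [m2]] [[m1'] [m2']] /=.
rewrite (Prop_irrelevance m1' m1) (Prop_irrelevance m2' m2) => hf hf'.
by rewrite (Prop_irrelevance hf' hf).
Qed.

Definition mor_id M : grMor M M :=
  @GrMor _ _ _ M M (idfun : {linear M -> M}) (fun g x xM => xM).

Definition mor_comp M N P (v : grMor N P) (u : grMor M N) : grMor M P :=
  @GrMor _ _ _ M P (v \o u : {linear M -> P})
    (fun g x xM => mor_homog v (mor_homog u xM)).

End Category.

Record grFunctor (G H : zmodType) (R S : comPzRingType)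
    (gR : grRing G R) (gS : grRing H S) := GrFunctor {
  fobj :> grMod gR -> grMod gS;
  fmap : forall M N, grMor M N -> grMor (fobj M) (fobj N);
  fmap_id : forall M, fmap (mor_id M) = mor_id (fobj M);
  fmap_comp : forall M N P (v : grMor N P) (u : grMor M N),
    fmap (mor_comp v u) = mor_comp (fmap v) (fmap u) }.

Definition functor_comp (G H K : zmodType) (R S T : comPzRingType)
    (gR : grRing G R) (gS : grRing H S) (gT : grRing K T)
    (B : grFunctor gS gT) (A : grFunctor gR gS) : grFunctor gR gT.
Proof.
apply: (@GrFunctor _ _ _ _ _ _ (fun M => B (A M))
  (fun M N u => fmap B (fmap A u))).
- by move=> M; rewrite !fmap_id.
- by move=> M N P v u; rewrite !fmap_comp.
Defined.

Record natTrans (G H : zmodType) (R S : comPzRingType)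
    (gR : grRing G R) (gS : grRing H S) (A B : grFunctor gR gS) := NatTrans {
  nt_mor :> forall M, grMor (A M) (B M);
  nt_natural : forall M N (u : grMor M N),
    mor_comp (nt_mor N) (fmap A u) = mor_comp (fmap B u) (nt_mor M) }.

Definition is_functor_iso (G H : zmodType) (R S : comPzRingType)
    (gR : grRing G R) (gS : grRing H S) (A B : grFunctor gR gS)
    (eta : natTrans A B) : Prop :=
  exists theta : natTrans B A, forall M,
    mor_comp (theta M) (eta M) = mor_id (A M) /\
    mor_comp (eta M) (theta M) = mor_id (B M).

Section Shift.
Variables (G : zmodType) (R : comPzRingType) (gR : grRing G R).

Lemma shift_direct (M : grMod gR) (g : G) :
  is_direct_sum (fun a => homog M (a + g)).
Proof.
move=> x; exists (fun a => part (mod_grading M) x (a + g)); split; first split.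
- by move=> a; apply: part_in.
- have [s _ xs] := fin_suppP (part_fin (mod_grading M) x).
  apply: (@fin_supp_sub _ _ _ [seq a - g | a <- s]) => a /negP as_.
  apply: xs; apply/negP => ags; apply: as_.
  by apply/mapP; exists (a + g); rewrite // addrK.
- rewrite {1}(part_sum (mod_grading M) x).
  apply: (reindex_fsbigT (fun a => a + g)).
  by exists (fun a => a - g) => a; rewrite ?addrK ?subrK.
- move=> f [fM ff xf]; apply/funext => a.
  rewrite (@part_uniq _ _ (mod_grading M) x (fun a => f (a - g))) ?addrK //.
  + by move=> b; have := fM (b - g); rewrite subrK.
  + have [s _ fs] := fin_suppP ff.
    apply: (@fin_supp_sub _ _ _ [seq b + g | b <- s]) => b /negP bs.
    apply: fs; apply/negP => bgs; apply: bs.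
    by apply/mapP; exists (b - g); rewrite // subrK.
  + rewrite xf; symmetry; rewrite (reindex_fsbigT (fun a => a + g)) //.
      by apply: eq_fsbigr => b _; rewrite addrK.
    by exists (fun a => a - g) => b; rewrite ?addrK ?subrK.
Qed.

Lemma shift_gradedZ (M : grMod gR) (g : G) (a b : G) (r : R) (x : M) :
  r \in gR a -> x \in homog M (b + g) -> r *: x \in homog M (a + b + g).
Proof. by move=> ra xb; rewrite -addrA; apply: mod_gradedZ. Qed.

Definition shift (M : grMod gR) (g : G) : grMod gR :=
  @GrMod _ _ gR M (Grading (@shift_direct M g)) (@shift_gradedZ M g).

End Shift.

Section Coarsening.
Variables (G H : zmodType) (psi : {additive G -> H}).
Variables (R : comPzRingType) (gR : grRing G R).

Lemma coarsen_ring_gradedM (g h : H) (a b : R) :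
  a \in coarsen_grading psi gR g -> b \in coarsen_grading psi gR h ->
  a * b \in coarsen_grading psi gR (g + h).
Proof.
move=> /family_sumP[f [fR ff ->]] /family_sumP[u [uR fu ->]].
have [s us fs] := fin_suppP ff; have [t ut uts] := fin_suppP fu.
rewrite (fsum_seq _ us fs) (fsum_seq _ ut uts) mulr_suml.
apply: rpred_sum => i; rewrite inE /= => ig; rewrite mulr_sumr.
apply: rpred_sum => j; rewrite inE /= => jh.
rewrite -ig -jh -raddfD; apply: coarse_in; exact: ring_gradedM.
Qed.

Definition coarsen_ring : grRing H R := GrRing coarsen_ring_gradedM.

Lemma coarsen_mod_gradedZ (M : grMod gR) (g h : H) (a : R) (x : M) :
  a \in coarsen_ring g -> x \in coarsen_grading psi (mod_grading M) h ->
  a *: x \in coarsen_grading psi (mod_grading M) (g + h).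
Proof.
move=> /family_sumP[f [fR ff ->]] /family_sumP[u [uR fu ->]].
have [s us fs] := fin_suppP ff; have [t ut uts] := fin_suppP fu.
rewrite (fsum_seq _ us fs) (fsum_seq _ ut uts) scaler_suml.
apply: rpred_sum => i; rewrite inE /= => ig; rewrite scaler_sumr.
apply: rpred_sum => j; rewrite inE /= => jh.
rewrite -ig -jh -raddfD; apply: coarse_in; exact: mod_gradedZ.
Qed.

Definition coarsen_mod (M : grMod gR) : grMod coarsen_ring :=
  GrMod (@coarsen_mod_gradedZ M).

Lemma coarsen_mor_homog (M N : grMod gR) (u : grMor M N) (h : H) (x : M) :
  x \in homog (coarsen_mod M) h -> u x \in homog (coarsen_mod N) h.
Proof.
move=> /family_sumP[f [fM ff ->]]; have [s us fs] := fin_suppP ff.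
rewrite (fsum_seq _ us fs) linear_sum.
apply: rpred_sum => i; rewrite inE /= => <-.
by apply: coarse_in; apply: mor_homog.
Qed.

Definition coarsen_mor (M N : grMod gR) (u : grMor M N) :
    grMor (coarsen_mod M) (coarsen_mod N) :=
  @GrMor _ _ _ (coarsen_mod M) (coarsen_mod N) (mor_lin u) (coarsen_mor_homog u).

Definition coarsen : grFunctor gR coarsen_ring.
Proof.
by apply: (@GrFunctor _ _ _ _ _ _ coarsen_mod coarsen_mor) => *; apply: grMor_ext.
Defined.

End Coarsening.

(* The graded Hom is realized as the internal direct sum, inside the R-module
   of functions M -> N with pointwise operations, of the subgroups hom_comp g of
   (underlying maps of) morphisms M -> N(g) in GrMod^G(R).  hom_direct proves
   that this sum is direct, and homog_GHomP that the component of degree g of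
   GHom M N is Hom_GrMod(M, N(g)). *)
Section GradedHom.
Variables (G : zmodType) (R : comPzRingType) (gR : grRing G R).
Variables M N : grMod gR.
Local Notation fct := (M -> N).

Definition hom_comp (g : G) : {pred fct} := fun f =>
  `[< exists u : grMor M (shift N g), f = (u : M -> N) >].

Lemma hom_compP g (f : fct) :
  f \in hom_comp g <->
  linear f /\ forall a x, x \in homog M a -> f x \in homog N (a + g).
Proof.
split=> [/asboolP[u ->]|[lf hf]].
  by split=> [c x y|a x xa]; [exact: linearP|exact: (mor_homog u)].
pose F : {linear M -> N} := HB.pack f (GRing.isLinear.Build R M N *:%R f lf).
by apply/asboolP; exists (@GrMor _ _ _ M (shift N g) F hf).
Qed.

Lemma hom_comp_zmod g : zmod_closed (hom_comp g).
Proof.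
split=> [|f f' /hom_compP[lf hf] /hom_compP[lf' hf']]; apply/hom_compP.
  by split=> [c x y|a x _]; rewrite ?scaler0 ?addr0 ?rpred0.
split=> [c x y|a x xa]; last by apply: rpredB; [exact: hf|exact: hf'].
rewrite -[LHS]/(f (c *: x + y) - f' (c *: x + y)).
rewrite -[(f - f') x]/(f x - f' x) -[(f - f') y]/(f y - f' y).
by rewrite lf lf' scalerBr opprD addrACA.
Qed.

HB.instance Definition _ g :=
  GRing.isZmodClosed.Build fct (hom_comp g) (hom_comp_zmod g).

Lemma hom_compZ a g c (f : fct) :
  c \in gR a -> f \in hom_comp g -> c *: f \in hom_comp (a + g).
Proof.
move=> ca /hom_compP[lf hf]; apply/hom_compP; split=> [d x y|b x xb].
  rewrite -[LHS]/(c *: f (d *: x + y)) -[(c *: f) x]/(c *: f x).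
  by rewrite -[(c *: f) y]/(c *: f y) lf scalerDr !scalerA mulrC.
rewrite addrCA; apply: mod_gradedZ => //; exact: hf.
Qed.

Definition hom_pred : {pred fct} :=
  family_sum (fun g => hom_comp g : zmodClosed fct) [set: G].

Lemma hom_pred_submod : submod_closed hom_pred.
Proof.
have hZ c (f : fct) : f \in hom_pred -> c *: f \in hom_pred.
  move=> /family_sumP[u [uh fu ->]]; have [s us fs] := fin_suppP fu.
  rewrite (fsumT_seq us fs) scaler_sumr; apply: rpred_sum => g _.
  have [t ut ct] := fin_suppP (part_fin gR c).
  rewrite (part_sum gR c) (fsumT_seq ut ct) scaler_suml.
  apply: rpred_sum => a _; apply: (@family_sum_in _ _ _ _ (a + g)) => //.
  by apply: hom_compZ; [exact: part_in|exact: uh].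
split=> [|c f f' hf hf']; first exact: rpred0.
by apply: rpredD => //; apply: hZ.
Qed.

HB.instance Definition _ := GRing.isSubmodClosed.Build R fct hom_pred hom_pred_submod.

Record hom_sort := HomSort { hom_fun : M -> N; hom_funP : hom_fun \in hom_pred }.

HB.instance Definition _ := [isSub for hom_fun].
HB.instance Definition _ := [Choice of hom_sort by <:].
HB.instance Definition _ := [SubChoice_isSubLmodule of hom_sort by <:].

Definition hom_grade (g : G) : {pred hom_sort} := fun u => hom_fun u \in hom_comp g.

Lemma hom_grade_zmod g : zmod_closed (hom_grade g).
Proof.
split=> [|u v uh vh]; rewrite unfold_in /hom_grade.
  by rewrite -[hom_fun 0]/(\val (0 : hom_sort)) raddf0; apply: rpred0.
by rewrite -[hom_fun _]/(\val (u - v)) raddfB; apply: rpredB.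
Qed.

HB.instance Definition _ g :=
  GRing.isZmodClosed.Build hom_sort (hom_grade g) (hom_grade_zmod g).

Lemma hom_part (u : G -> fct) a g x :
  (forall b, u b \in hom_comp b) -> fin_supp u -> x \in homog M a ->
  part (mod_grading N) ((\sum_(b \in [set: G]) u b) x) (a + g) = u g x.
Proof.
move=> uh fu xa; have [s us fs] := fin_suppP fu.
rewrite (@part_uniq _ _ (mod_grading N) _ (fun b => u (b - a) x)).
- by rewrite addrC addKr.
- by move=> b; have /hom_compP[_ /(_ _ _ xa)] := uh (b - a); rewrite addrCA subrr addr0.
- apply: (@fin_supp_sub _ _ _ [seq b + a | b <- s]) => b /negP bs.
  rewrite fs //; apply/negP => bas; apply: bs.
  by apply/mapP; exists (b - a); rewrite // subrK.
- rewrite (fsumT_seq us fs) fct_sumE.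
  rewrite (reindex_fsbigT (fun b => b + a)); last first.
    by exists (fun b => b - a) => b; rewrite ?addrK ?subrK.
  rewrite (@fsumT_seq _ _ _ s) //; first by apply: eq_bigr => b _; rewrite addrK.
  by move=> b /fs ub; rewrite addrK ub.
Qed.

Lemma hom_direct : is_direct_sum (fun g => hom_grade g : zmodClosed hom_sort).
Proof.
move=> f; have /family_sumP[w [wh fw fE]] := hom_funP f.
have wP g : w g \in hom_pred by apply: (@family_sum_in _ _ _ _ g).
have [s us ws] := fin_suppP fw.
have w0 g : g \notin s -> HomSort (wP g) = 0 by move=> /ws wg; apply: val_inj.
exists (fun g => HomSort (wP g)); split; first split.
- by move=> g; apply: wh.
- exact: (@fin_supp_sub _ _ _ s).
- apply: val_inj; rewrite (fsumT_seq us w0) raddf_sum /=.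
  by rewrite [LHS]fE (fsumT_seq us ws).
- move=> v [vh fv vE]; apply/funext => g; apply: val_inj; apply/funext => x /=.
  have [t ut vt] := fin_suppP fv.
  have fv' : fin_supp (fun b => hom_fun (v b)).
    by apply: (@fin_supp_sub _ _ _ t) => b /vt ->.
  have fE' : hom_fun f = \sum_(b \in [set: G]) hom_fun (v b).
    rewrite (@fsumT_seq _ _ _ t) //; last by move=> b /vt ->.
    by rewrite -[hom_fun f]/(\val f) vE (fsumT_seq ut vt) raddf_sum.
  have E a y : y \in homog M a -> w g y = hom_fun (v g) y.
    by move=> ya; rewrite -(hom_part g wh fw ya) -(hom_part g vh fv' ya) -fE -fE'.
  have /hom_compP[lw _] := wh g.
  have /hom_compP[lv _] := vh g : hom_fun (v g) \in hom_comp g.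
  pose W : {linear M -> N} := HB.pack (w g) (GRing.isLinear.Build R M N *:%R _ lw).
  pose V : {linear M -> N} :=
    HB.pack (hom_fun (v g)) (GRing.isLinear.Build R M N *:%R _ lv).
  rewrite -[LHS]/(W x) -[RHS]/(V x); have [r ur xr] := fin_suppP (part_fin (mod_grading M) x).
  rewrite (part_sum (mod_grading M) x) (fsumT_seq ur xr) !linear_sum.
  by apply: eq_bigr => a _; apply: (E a); apply: part_in.
Qed.

Lemma hom_gradedZ (a g : G) (c : R) (u : hom_sort) :
  c \in gR a -> u \in hom_grade g -> c *: u \in hom_grade (a + g).
Proof.
move=> ca ug; rewrite unfold_in /hom_grade -[hom_fun _]/(\val (c *: u)) linearZ.
exact: hom_compZ.
Qed.

Definition GHom : grMod gR :=
  @GrMod _ _ gR hom_sort (Grading hom_direct) hom_gradedZ.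

Lemma hom_of_subproof (g : G) (u : grMor M (shift N g)) : (u : M -> N) \in hom_pred.
Proof.
by apply: (@family_sum_in _ _ _ _ g) => //; apply/asboolP; exists u.
Qed.

Definition hom_of (g : G) (u : grMor M (shift N g)) : GHom :=
  HomSort (hom_of_subproof u).

Lemma homog_GHomP (g : G) (f : GHom) :
  f \in homog GHom g <-> exists u : grMor M (shift N g), f = hom_of u.
Proof.
split=> [/asboolP[u fu]|[u ->]]; last by apply/asboolP; exists u.
by exists u; apply: val_inj.
Qed.

End GradedHom.

Arguments hom_comp {G R gR} M N g _.
Arguments hom_pred {G R gR} M N _.

Section GradedHomFunctor.
Variables (G : zmodType) (R : comPzRingType) (gR : grRing G R) (M : grMod gR).

Lemma hom_postcomp_comp (N P : grMod gR) (v : grMor N P) g (f : M -> N) :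
  f \in hom_comp M N g -> v \o f \in hom_comp M P g.
Proof.
move=> /hom_compP[lf hf]; apply/hom_compP; split=> [c x y|a x xa] /=.
  by rewrite lf linearP.
by apply: mor_homog; apply: hf.
Qed.

Lemma hom_postcomp_subproof (N P : grMod gR) (v : grMor N P) (f : GHom M N) :
  v \o hom_fun f \in hom_pred M P.
Proof.
have /family_sumP[u [uh fu ->]] := hom_funP f; have [s us fs] := fin_suppP fu.
have -> : v \o \sum_(g \in [set: G]) u g = \sum_(g <- s) (v \o u g).
  by apply/funext => x; rewrite (fsumT_seq us fs) /= !fct_sumE linear_sum.
apply: rpred_sum => g _; apply: (@family_sum_in _ _ _ _ g) => //.
exact: hom_postcomp_comp.
Qed.

Definition hom_postcomp (N P : grMod gR) (v : grMor N P) (f : GHom M N) : GHom M P :=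
  HomSort (hom_postcomp_subproof v f).

Lemma hom_postcomp_linear (N P : grMod gR) (v : grMor N P) :
  linear (hom_postcomp v).
Proof.
move=> c f f'; apply: val_inj; apply/funext => x.
exact: (linearP (mor_lin v)).
Qed.

HB.instance Definition _ (N P : grMod gR) (v : grMor N P) :=
  GRing.isLinear.Build R (GHom M N) (GHom M P) *:%R (hom_postcomp v)
    (hom_postcomp_linear v).

Lemma hom_postcomp_homog (N P : grMod gR) (v : grMor N P) g (f : GHom M N) :
  f \in homog (GHom M N) g -> hom_postcomp v f \in homog (GHom M P) g.
Proof. exact: hom_postcomp_comp. Qed.

Definition GHom_map (N P : grMod gR) (v : grMor N P) : grMor (GHom M N) (GHom M P) :=
  @GrMor _ _ _ (GHom M N) (GHom M P) (hom_postcomp v) (hom_postcomp_homog v).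

Definition GHom_functor : grFunctor gR gR.
Proof.
apply: (@GrFunctor _ _ _ _ _ _ (GHom M) GHom_map).
- by move=> N; apply: grMor_ext => f; apply: val_inj.
- by move=> N P Q v u; apply: grMor_ext => f; apply: val_inj.
Defined.

End GradedHomFunctor.

(* Coarsening leaves underlying maps unchanged, so in terms of internal direct
   sums the morphism induced by the maps u |-> u_[psi] on homogeneous components
   (coarsen_shift) also does; hpsi_hom_of checks it on the components, which
   determines it by additivity. *)
Section CanonicalMorphism.
Variables (G H : zmodType) (psi : {additive G -> H}).
Variables (R : comPzRingType) (gR : grRing G R) (M : grMod gR).
Local Notation C := (coarsen psi gR).

Lemma coarsen_shift_homog (N : grMod gR) (g : G) (u : grMor M (shift N g))
    (h : H) (x : M) :
  x \in homog (C M) h -> u x \in homog (shift (C N) (psi g)) h.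
Proof.
move=> /family_sumP[f [fM ff ->]]; have [s us fs] := fin_suppP ff.
rewrite (fsum_seq _ us fs) linear_sum.
apply: rpred_sum => i; rewrite inE /= => <-.
suff: u (f i) \in homog (C N) (psi (i + g)) by rewrite raddfD.
by apply: coarse_in; apply: (mor_homog u).
Qed.

(* u_[psi] as a morphism M_[psi] -> N_[psi](psi g). *)
Definition coarsen_shift (N : grMod gR) (g : G) (u : grMor M (shift N g)) :
    grMor (C M) (shift (C N) (psi g)) :=
  @GrMor _ _ _ (C M) (shift (C N) (psi g)) (mor_lin u) (coarsen_shift_homog u).

Lemma hpsi_comp (N : grMod gR) (g : G) (f : M -> N) :
  f \in hom_comp M N g -> (f : C M -> C N) \in hom_comp (C M) (C N) (psi g).
Proof. by move=> /asboolP[u ->]; apply/asboolP; exists (coarsen_shift u). Qed.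

Lemma hpsi_subproof (N : grMod gR) (f : GHom M N) :
  (hom_fun f : C M -> C N) \in hom_pred (C M) (C N).
Proof.
have /family_sumP[u [uh fu ->]] := hom_funP f; have [s us fs] := fin_suppP fu.
rewrite (fsumT_seq us fs); apply: (@rpred_sum (C M -> C N)) => g _.
by apply: (@family_sum_in _ _ _ _ (psi g)) => //; apply: hpsi_comp.
Qed.

Definition hpsi_fun (N : grMod gR) (f : C (GHom M N)) : GHom (C M) (C N) :=
  HomSort (hpsi_subproof f).

Lemma hpsi_linear (N : grMod gR) : linear (@hpsi_fun N).
Proof. by move=> c f f'; apply: val_inj. Qed.

HB.instance Definition _ (N : grMod gR) :=
  GRing.isLinear.Build R (C (GHom M N)) (GHom (C M) (C N)) *:%R (@hpsi_fun N)
    (@hpsi_linear N).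

Lemma hpsi_homog (N : grMod gR) (h : H) (f : C (GHom M N)) :
  f \in homog (C (GHom M N)) h -> hpsi_fun f \in homog (GHom (C M) (C N)) h.
Proof.
move=> /family_sumP[u [uh fu ->]]; have [s us fs] := fin_suppP fu.
rewrite (fsum_seq _ us fs) linear_sum.
apply: rpred_sum => g; rewrite inE /= => <-; exact: (hpsi_comp (uh g)).
Qed.

Definition hpsi_mor (N : grMod gR) : grMor (C (GHom M N)) (GHom (C M) (C N)) :=
  @GrMor _ _ _ (C (GHom M N)) (GHom (C M) (C N)) (@hpsi_fun N) (@hpsi_homog N).

Lemma hpsi_hom_of (N : grMod gR) (g : G) (u : grMor M (shift N g)) :
  hpsi_mor N (hom_of u) = hom_of (coarsen_shift u).
Proof. exact: val_inj. Qed.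

Lemma hpsi_inj (N : grMod gR) : injective (hpsi_mor N).
Proof. by move=> f f' /(congr1 (@hom_fun _ _ _ _ _)) ff'; apply: val_inj. Qed.

Definition hpsi :
  natTrans (functor_comp C (GHom_functor M))
           (functor_comp (GHom_functor (C M)) C).
Proof.
apply: (@NatTrans _ _ _ _ _ _ (functor_comp C (GHom_functor M))
  (functor_comp (GHom_functor (C M)) C) hpsi_mor).
by move=> N P v; apply: grMor_ext => f; apply: val_inj.
Defined.

End CanonicalMorphism.

(* Subgroups are the boolean predicates closed under 0 and subtraction; with
   classical logic every subgroup is of this form. *)
Definition quot_proj (G : zmodType) (F : zmodClosed G) :
  {additive G -> Quotient.quot F} := \pi_(Quotient.quot F)%qT.

Definition to_trivial (G : zmodType) : {additive G -> 'I_1} := \0.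

(* Main.v *)
Require Import Defs.
From HB Require Import structures.
From mathcomp Require Import all_boot all_order all_algebra.
From mathcomp Require Import all_classical.

Set Implicit Arguments.
Unset Strict Implicit.
Unset Printing Implicit Defensive.

Import GRing.Theory.
Local Open Scope classical_set_scope.
Local Open Scope ring_scope.

(* Since hpsi does not change underlying maps, it suffices that every R-linear
   map f : M -> N is a finite sum of homogeneous ones.  In general f is the
   pointwise finite sum of its components f_b of degree b.  If f_b <> 0 for
   pairwise distinct b = b_0, b_1, ..., choose distinct elements c_n of F: the
   family (f_(b_n)) defines a map g from M to the direct sum N' of the shifts
   N(b_n - c_n), whose n-th entry is homogeneous of degree c_n, so that g has
   degree 0 for the G/F-gradings.  By surjectivity of h_pi at N', g has only
   finitely many nonzero components, whereas its component of degree c_n is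
   nonzero for all n. *)

(** * Injective sequences in infinite sets, and supports *)

Lemma infinite_set_inj_nat (T : choiceType) (A : set T) : infinite_set A ->
  exists2 c : nat -> T, injective c & forall n, A (c n).
Proof.
move=> /infiniteP/card_leP[c]; exists (fun n => val (c (SigSub (mem_setT n)))).
  move=> m n /val_inj /(@inj _ _ _ c _ _ (in_setT _) (in_setT _)).
  by move/(congr1 val).
by move=> n; rewrite -inE; apply: valP.
Qed.

Lemma fin_supp_comp (I J : choiceType) (V : zmodType) (f : J -> V) (c : I -> J) :
  injective c -> fin_supp f -> fin_supp (f \o c).
Proof.
by move=> cI ff; apply: (@finite_preimage _ _ [set j | f j != 0] c) => // x y _ _; apply: cI.
Qed.

(** * Homogeneous parts under scaling and shifting *)

Section PartLinear.
Variables (G : zmodType) (R : comPzRingType) (gR : grRing G R).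

(** Multiplying the parts of [x] by [c] and moving their degrees by [k] gives a homogeneous
    decomposition of [c *: x], and such decompositions are unique. *)
Lemma part_scale (M : grMod gR) k c (x : M) a :
  c \in gR k -> part (mod_grading M) (c *: x) (k + a) = c *: part (mod_grading M) x a.
Proof.
move=> ck.
rewrite (@part_uniq _ _ (mod_grading M) _ (fun d => c *: part (mod_grading M) x (d - k))).
- by rewrite addrC addKr.
- move=> d; have -> : d = k + (d - k) by rewrite addrC subrK.
  by apply: mod_gradedZ => //; rewrite [k + _]addrC addrK; apply: part_in.
- have [s _ xs] := fin_suppP (part_fin (mod_grading M) x).
  apply: (@fin_supp_sub _ _ _ [seq a + k | a <- s]) => d /negP ds.
  rewrite xs ?scaler0 //; apply/negP => dks; apply: ds.
  by apply/mapP; exists (d - k); rewrite ?subrK.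
- have [s us xs] := fin_suppP (part_fin (mod_grading M) x).
  rewrite {1}(part_sum (mod_grading M) x) (fsumT_seq us xs) scaler_sumr.
  rewrite (reindex_fsbigT (fun b => b + k)); last first.
    by exists (fun b => b - k) => b; rewrite ?addrK ?subrK.
  rewrite (@fsumT_seq _ _ _ s) //.
    by apply: eq_bigr => b _; rewrite addrK.
  by move=> b /xs xb; rewrite addrK xb scaler0.
Qed.

Lemma part_shift (M : grMod gR) g (x : M) a :
  part (mod_grading (shift M g)) x a = part (mod_grading M) x (a + g).
Proof.
rewrite (@part_uniq _ _ (mod_grading (shift M g)) x (fun a => part (mod_grading M) x (a + g))) //.
- by move=> b; apply: part_in.
- by apply: (@fin_supp_comp _ _ _ _ (+%R^~ g)); [apply: addIr | apply: part_fin].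
- rewrite {1}(part_sum (mod_grading M) x); apply: (reindex_fsbigT (+%R^~ g)).
  by exists (+%R^~ (- g)) => b; rewrite ?addrK ?subrK.
Qed.

End PartLinear.

(** * Decomposition of a linear map into components of given degree *)

Section DegreeComponents.
Variables (G : zmodType) (R : comPzRingType) (gR : grRing G R) (M N : grMod gR).
Variable f : {linear M -> N}.
Local Notation pM := (part (mod_grading M)).
Local Notation pN a := (part (mod_grading (shift N a)) : N -> G -> N).

(* On M_a, the component of degree b of f is x |-> f(x)_(b + a). *)
Definition degree_component (b : G) (x : M) : N :=
  \sum_(a \in [set: G]) pN a (f (pM x a)) b.

Let f_part0 x a b : pM x a = 0 -> pN a (f (pM x a)) b = 0.
Proof. by move=> ->; rewrite linear0 part0. Qed.

Lemma degree_component_seq (s : seq G) b x :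
  uniq s -> (forall a, a \notin s -> pM x a = 0) ->
  degree_component b x = \sum_(a <- s) pN a (f (pM x a)) b.
Proof. by move=> us xs; apply: fsumT_seq => // a /xs; apply: f_part0. Qed.

Lemma degree_component_homog b a x :
  x \in homog M a -> degree_component b x = pN a (f x) b.
Proof.
move=> xa; rewrite (@degree_component_seq [:: a]) //.
  by rewrite big_seq1 (part_homog xa) /single eqxx.
by move=> d; rewrite inE (part_homog xa) /single => /negbTE ->.
Qed.

Lemma degree_componentD b x y :
  degree_component b (x + y) = degree_component b x + degree_component b y.
Proof.
have [s [us xs ys]] := fin_suppP2 (part_fin (mod_grading M) x) (part_fin (mod_grading M) y).
rewrite !(degree_component_seq _ us) // -?big_split.
  by apply: eq_bigr => a _; rewrite partD linearD partD.
by move=> a a_s; rewrite partD xs // ys // addr0.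
Qed.

Lemma degree_component0 b : degree_component b 0 = 0.
Proof. by rewrite (degree_component_homog b (rpred0 (homog M 0))) linear0 part0. Qed.

Lemma degree_component_sum b (J : Type) (s : seq J) (F : J -> M) :
  degree_component b (\sum_(j <- s) F j) = \sum_(j <- s) degree_component b (F j).
Proof. by rewrite (big_morph _ (degree_componentD b) (degree_component0 b)). Qed.

(** Additivity reduces to [c] and [x] homogeneous, of degrees [k] and [a]. Scaling by [c] then
    raises degrees by [k] in both [M] and [N], so the difference of degrees [b] is preserved. *)
Lemma degree_componentZ b c x : degree_component b (c *: x) = c *: degree_component b x.
Proof.
have [s us xs] := fin_suppP (part_fin (mod_grading M) x).
have [t ut ct] := fin_suppP (part_fin gR c).
rewrite (part_sum gR c) (fsumT_seq ut ct) !scaler_suml degree_component_sum.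
apply: eq_bigr => k _.
rewrite (part_sum (mod_grading M) x) (fsumT_seq us xs).
rewrite scaler_sumr !degree_component_sum scaler_sumr; apply: eq_bigr => a _.
have ck := part_in gR c k; have xa := part_in (mod_grading M) x a.
rewrite (degree_component_homog b (mod_gradedZ ck xa)) (degree_component_homog b xa).
by rewrite linearZ !part_shift addrCA part_scale.
Qed.

Lemma degree_component_in b : degree_component b \in hom_comp M N b.
Proof.
apply/hom_compP; split=> [c x y|a x xa]; first by rewrite degree_componentD degree_componentZ.
by rewrite (degree_component_homog b xa) addrC; apply: part_in.
Qed.

(** [x] has finitely many nonzero parts, and the image of each has finitely many; the list [t]
    collects all degrees that occur. It depends on [x]: no bound uniform in [x] holds in general. *)
Let degrees_bounded x : exists2 t : seq G, uniq t &
  forall b, b \notin t -> forall a, degree_component b (pM x a) = 0.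
Proof.
have [s us xs] := fin_suppP (part_fin (mod_grading M) x).
have [t tP] : exists t : seq G, forall b, b \notin t ->
    forall a, a \in s -> degree_component b (pM x a) = 0.
  elim: (s) => [|a r [t tP]]; first by exists [::].
  have [t' _ tP'] := fin_suppP (part_fin (mod_grading (shift N a)) (f (pM x a))).
  exists (t' ++ t) => b; rewrite mem_cat negb_or => /andP[bt' bt] d.
  rewrite inE => /predU1P[->|]; last exact: tP.
  by rewrite (degree_component_homog b (part_in _ x a)); apply: tP'.
exists (undup t) => [|b]; first exact: undup_uniq.
rewrite mem_undup => bt a; have [/(tP b bt)//|/xs ->] := boolP (a \in s).
exact: degree_component0.
Qed.

Let degree_component_parts x s b : uniq s -> (forall a, a \notin s -> pM x a = 0) ->
  degree_component b x = \sum_(a <- s) degree_component b (pM x a).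
Proof.
by move=> us xs; rewrite {1}(part_sum (mod_grading M) x) (fsumT_seq us xs) degree_component_sum.
Qed.

Lemma fin_supp_degree_component x : fin_supp (degree_component ^~ x).
Proof.
have [s us xs] := fin_suppP (part_fin (mod_grading M) x).
have [t _ tP] := degrees_bounded x; apply: (@fin_supp_sub _ _ _ t) => b bt.
by rewrite (degree_component_parts b us xs) big1 // => a _; apply: tP.
Qed.

Lemma sum_degree_component x : f x = \sum_(b \in [set: G]) degree_component b x.
Proof.
have [s us xs] := fin_suppP (part_fin (mod_grading M) x).
have [t ut tP] := degrees_bounded x.
rewrite (fsumT_seq ut) => [|b bt]; last first.
  by rewrite (degree_component_parts b us xs) big1 // => a _; apply: tP.
under eq_bigr do rewrite (degree_component_parts _ us xs).
(* After exchanging the sums, the inner sum for [a] is the decomposition of [f (pM x a)] in the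
   grading of [N(a)]. *)
rewrite exchange_big {1}(part_sum (mod_grading M) x) (fsumT_seq us xs) linear_sum.
apply: eq_bigr => a _; rewrite -(fsumT_seq ut (fun b bt => tP b bt a)).
rewrite {1}(part_sum (mod_grading (shift N a)) (f (pM x a))).
by apply: eq_fsbigr => b _; rewrite (degree_component_homog b (part_in _ x a)).
Qed.

(** A finite set of degrees valid for all [x] at once turns the pointwise sum into a finite sum of
    maps, as membership in [hom_pred] demands. *)
Lemma hom_pred_of_fin_degrees :
  finite_set [set b | degree_component b != 0] -> (f : M -> N) \in hom_pred M N.
Proof.
move=> fin; apply/family_sumP; exists degree_component; split=> //.
  exact: degree_component_in.
have [s us fs] := fin_suppP (fin : fin_supp degree_component).
apply/funext => x; rewrite sum_degree_component (fsumT_seq us fs) fct_sumE.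
by apply: fsumT_seq => // b /fs ->.
Qed.

End DegreeComponents.

(** * Direct sums of shifted modules *)

Section SumOfShifts.
Variables (G : zmodType) (R : comPzRingType) (gR : grRing G R) (N : grMod gR).
Variables (I : choiceType) (s : I -> G).

(* The direct sum of the shifts N(s i), i in I: the finitely supported functions
   I -> N, of degree g when the i-th entry has degree g + s i in N. *)
Definition fin_supp_pred : {pred I -> N} := fun u => `[< fin_supp u >].

Lemma fin_supp_pred_submod : submod_closed fin_supp_pred.
Proof.
split=> [|c u v /asboolP fu /asboolP fv]; first exact/asboolP/fin_supp0.
have [r [_ ur vr]] := fin_suppP2 fu fv; apply/asboolP.
apply: (@fin_supp_sub _ _ _ r) => i ir.
by rewrite -[LHS]/(c *: u i + v i) ur // vr // scaler0 addr0.
Qed.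

HB.instance Definition _ :=
  GRing.isSubmodClosed.Build R (I -> N) fin_supp_pred fin_supp_pred_submod.

Record shift_sum_sort := ShiftSum {
  shift_sum_fun :> I -> N;
  shift_sum_funP : shift_sum_fun \in fin_supp_pred }.

HB.instance Definition _ := [isSub for shift_sum_fun].
HB.instance Definition _ := [Choice of shift_sum_sort by <:].
HB.instance Definition _ := [SubChoice_isSubLmodule of shift_sum_sort by <:].

Definition shift_sum_comp (g : G) : {pred shift_sum_sort} :=
  fun u => `[< forall i, u i \in homog (shift N (s i)) g >].

Lemma shift_sum_comp_zmod g : zmod_closed (shift_sum_comp g).
Proof.
split=> [|u v /asboolP uh /asboolP vh]; apply/asboolP => i.
  by rewrite -[shift_sum_fun 0]/(\val (0 : shift_sum_sort)) raddf0; apply: rpred0.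
rewrite -[shift_sum_fun _]/(\val (u - v)) raddfB.
exact: (rpredB (uh i) (vh i)).
Qed.

HB.instance Definition _ g :=
  GRing.isZmodClosed.Build shift_sum_sort (shift_sum_comp g) (shift_sum_comp_zmod g).

Lemma shift_sum_sumE (J : Type) (r : seq J) (F : J -> shift_sum_sort) i :
  (\sum_(j <- r) F j : shift_sum_sort) i = \sum_(j <- r) F j i.
Proof.
by rewrite -[shift_sum_fun _]/(\val (\sum_(j <- r) F j)) raddf_sum fct_sumE.
Qed.

Local Notation pN i := (part (mod_grading (shift N (s i))) : N -> G -> N).

Lemma shift_sum_part_subproof (u : shift_sum_sort) g :
  (fun i => pN i (u i) g) \in fin_supp_pred.
Proof.
have [r _ ur] := fin_suppP (asboolW (shift_sum_funP u)).
apply/asboolP; apply: (@fin_supp_sub _ _ _ r) => i /ur ->.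
exact: part0.
Qed.

Definition shift_sum_part u g := ShiftSum (shift_sum_part_subproof u g).

(** Evaluation at [i] turns a decomposition in the direct sum into one in [N(s i)], where it is
    unique. This serves both the directness of the grading and the computation of its parts. *)
Lemma shift_sum_part_uniq (u : shift_sum_sort) (v : G -> shift_sum_sort) g i :
  (forall g, v g \in shift_sum_comp g) -> fin_supp v ->
  u = \sum_(g \in [set: G]) v g -> pN i (u i) g = v g i.
Proof.
move=> vh /fin_suppP[q uq vq] uE.
rewrite (@part_uniq _ _ (mod_grading (shift N (s i))) (u i) (fun g => v g i)) //.
- by move=> b; apply: (asboolW (vh b)).
- by apply: (@fin_supp_sub _ _ _ q) => b /vq ->.
- rewrite uE (fsumT_seq uq vq) shift_sum_sumE.
  by symmetry; apply: (@fsumT_seq G N) => // b /vq ->.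
Qed.

Lemma shift_sum_direct :
  is_direct_sum (fun g => shift_sum_comp g : zmodClosed shift_sum_sort).
Proof.
move=> u; have [r ur0 ur] := fin_suppP (asboolW (shift_sum_funP u)).
(* Only the finitely many entries indexed by [r] are nonzero, so one finite list of degrees serves
   all entries; in a full product this could fail. *)
have [t ut tP] : exists2 t : seq G, uniq t & forall g, g \notin t ->
    forall i, pN i (u i) g = 0.
  have [t tP] : exists t : seq G, forall g, g \notin t ->
      forall i, i \in r -> pN i (u i) g = 0.
    elim: (r) => [|i q [t tP]]; first by exists [::].
    have [t' _ tP'] := fin_suppP (part_fin (mod_grading (shift N (s i))) (u i)).
    exists (t' ++ t) => g; rewrite mem_cat negb_or => /andP[gt' gt] j.
    by rewrite inE => /predU1P[->|]; [apply: tP' | apply: tP].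
  exists (undup t) => [|g]; first exact: undup_uniq.
  rewrite mem_undup => gt i; have [/(tP g gt)//|/ur ->] := boolP (i \in r).
  exact: part0.
have p0 g : g \notin t -> shift_sum_part u g = 0.
  by move=> /tP gt; apply: val_inj; apply/funext => i; apply: gt.
exists (shift_sum_part u); split; first split.
- by move=> g; apply/asboolP => i; apply: part_in.
- exact: (@fin_supp_sub _ _ _ t).
- rewrite (fsumT_seq ut p0); apply: val_inj; apply/funext => i /=.
  rewrite shift_sum_sumE {1}(part_sum (mod_grading (shift N (s i))) (u i)).
  exact: (fsumT_seq ut (fun g gt => tP g gt i)).
- move=> v [vh /fin_suppP[q uq vq] uE]; apply/funext => g.
  apply: val_inj; apply/funext => i /=.
  by apply: shift_sum_part_uniq => //; apply: fin_supp_sub vq.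
Qed.

Lemma shift_sum_gradedZ (a b : G) (c : R) (u : shift_sum_sort) :
  c \in gR a -> u \in shift_sum_comp b -> c *: u \in shift_sum_comp (a + b).
Proof.
move=> ca /asboolP uh; apply/asboolP => i.
rewrite -[shift_sum_fun _]/(\val (c *: u)) linearZ.
exact: (@mod_gradedZ _ _ _ (shift N (s i)) _ _ _ _ ca (uh i)).
Qed.

Definition shift_sum : grMod gR :=
  @GrMod _ _ gR shift_sum_sort (Grading shift_sum_direct) shift_sum_gradedZ.

Lemma part_shift_sum (u : shift_sum) g i :
  (part (mod_grading shift_sum) u g : shift_sum_sort) i = pN i ((u : shift_sum_sort) i) g.
Proof.
symmetry; apply: shift_sum_part_uniq.
- exact: (part_in (mod_grading shift_sum) u).
- exact: (part_fin (mod_grading shift_sum) u).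
- exact: (part_sum (mod_grading shift_sum) u).
Qed.

End SumOfShifts.

Arguments fin_supp_pred {G R gR} N I _.

(** * Bijective graded morphisms *)

Section GradedMorphisms.
Variables (G : zmodType) (R : comPzRingType) (gR : grRing G R).

Lemma grMor_part (P Q : grMod gR) (u : grMor P Q) (x : P) g :
  part (mod_grading Q) (u x) g = u (part (mod_grading P) x g).
Proof.
have [s us xs] := fin_suppP (part_fin (mod_grading P) x).
have xs' a : a \notin s -> u (part (mod_grading P) x a) = 0 by move=> /xs ->; rewrite linear0.
rewrite (@part_uniq _ _ (mod_grading Q) (u x) (fun g => u (part (mod_grading P) x g))) //.
- by move=> a; apply: (mor_homog u); apply: part_in.
- exact: fin_supp_sub xs'.
- by rewrite (fsumT_seq us xs') {1}(part_sum (mod_grading P) x) (fsumT_seq us xs) linear_sum.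
Qed.

(** The inverse preserves degrees since [u] commutes with taking parts: for [y] of degree [g], [v y]
    and its part of degree [g] have the same image under [u]. *)
Lemma grMor_bij_inv (P Q : grMod gR) (u : grMor P Q) :
  injective u -> (forall y, exists x, u x = y) ->
  exists v : grMor Q P, mor_comp v u = mor_id P /\ mor_comp u v = mor_id Q.
Proof.
move=> uI /choice[v vK].
have vl : linear v by move=> c x y; apply: uI; rewrite linearP !vK.
have vh g y : y \in homog Q g -> v y \in homog P g.
  move=> yg; suff -> : v y = part (mod_grading P) (v y) g by apply: part_in.
  by apply: uI; rewrite -grMor_part vK (part_homog yg) /single eqxx.
pose V : {linear Q -> P} := HB.pack v (GRing.isLinear.Build R Q P *:%R v vl).
exists (@GrMor _ _ _ Q P V vh); split; apply: grMor_ext => x /=; last exact: vK.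
by apply: uI; apply: vK.
Qed.

End GradedMorphisms.

(** * Functor isomorphisms and bijectivity on each module *)

Section FunctorIsomorphisms.
Variables (G H : zmodType) (R S : comPzRingType) (gR : grRing G R) (gS : grRing H S).

(** The objectwise inverses form a natural family: injectivity of [eta P] reduces their naturality
    to that of [eta]. *)
Lemma bij_functor_iso (A B : grFunctor gR gS) (eta : natTrans A B) :
  (forall N, injective (eta N)) -> (forall N y, exists x, eta N x = y) ->
  is_functor_iso eta.
Proof.
move=> etaI etaS.
pose inv N := cid (grMor_bij_inv (@etaI N) (etaS N)).
pose theta N := projT1 (inv N); have thetaP N := projT2 (inv N).
suff nat_theta N P (u : grMor N P) :
    mor_comp (theta P) (Defs.fmap B u) = mor_comp (Defs.fmap A u) (theta N).
  by exists (NatTrans nat_theta).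
apply: grMor_ext => y; apply: (@etaI P).
have E N' z : eta N' (theta N' z) = z.
  by have [_ /(congr1 (fun w : grMor _ _ => w z))] := thetaP N'.
rewrite /= E.
have /(congr1 (fun w : grMor _ _ => w (theta N y))) /= -> := nt_natural eta u.
by rewrite E.
Qed.

Lemma functor_iso_surj (A B : grFunctor gR gS) (eta : natTrans A B) :
  is_functor_iso eta -> forall N y, exists x, eta N x = y.
Proof.
move=> [theta thetaP] N y; exists (theta N y).
by have [_ /(congr1 (fun w : grMor _ _ => w y))] := thetaP N.
Qed.

End FunctorIsomorphisms.

(** * Surjectivity for one coarsening with infinite kernel *)

Section InfiniteKernel.
Variables (G H : zmodType) (psi : {additive G -> H}).
Variables (R : comPzRingType) (gR : grRing G R) (M : grMod gR).
Hypothesis psi_ker : infinite_set [set g | psi g = 0].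
Hypothesis hpsi_surj : forall N y, exists x, hpsi psi M N x = y.

(** The conclusion no longer mentions [psi], which is what carries the result from one coarsening to
    all others. *)
Lemma linear_hom_pred (N : grMod gR) (f : {linear M -> N}) : (f : M -> N) \in hom_pred M N.
Proof.
apply: hom_pred_of_fin_degrees; apply: contrapT => /infinite_set_inj_nat[b bI fb].
have [c cI cK] := infinite_set_inj_nat psi_ker.
(* With this shift, [N_(a + b n)] is the component of degree [a + c n] of [N(s n)], and [psi] maps
   [a + c n] to [psi a]. *)
pose s n := b n - c n; pose N' := shift_sum N s.
(* At each [x] only finitely many components of [f] are nonzero, and [b] is injective; hence [g]
   lands in the direct sum. *)
have gP x : (fun n => degree_component f (b n) x) \in fin_supp_pred N nat.
  apply/asboolP.
  exact: (@fin_supp_comp _ _ _ (degree_component f ^~ x)) bI (fin_supp_degree_component f x).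
pose g x : N' := ShiftSum (gP x).
have part_g a x d n : x \in homog M a ->
    (part (mod_grading N') (g x) d : shift_sum_sort N nat) n =
    single (a + c n) (degree_component f (b n) x) d.
  move=> xa; rewrite part_shift_sum; apply: (congr1 (@^~ d)).
  apply: (part_homog (A := mod_grading (shift N (s n)))).
  have /hom_compP[_ /(_ _ _ xa)] := degree_component_in f (b n).
  by rewrite /= /homog /= /s addrA addrAC addrK.
have gl : linear g.
  move=> k x y; apply: val_inj; apply/funext => n.
  exact: etrans (degree_componentD _ _ _ _) (congr1 (+%R^~ _) (degree_componentZ _ _ _ _)).
pose gL : {linear M -> N'} := HB.pack g (GRing.isLinear.Build R M N' *:%R g gl).
have g0 : (g : coarsen psi gR M -> coarsen psi gR N') \in
    hom_comp (coarsen psi gR M) (coarsen psi gR N') 0.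
  apply/hom_compP; split=> [//|k x /family_sumP[u [uM fu ->]]].
  have [t ut ut0] := fin_suppP fu; rewrite (fsum_seq _ ut ut0).
  rewrite -[g _]/(gL _) linear_sum; apply: rpred_sum => a; rewrite inE /= addr0 => <-.
  change (g (u a) \in coarse_comp psi (mod_grading N') (psi a)).
  (* Membership in a coarsened component is tested on [G]-degrees [d]: a nonzero [n]-th entry forces
     [d = a + c n], whence [psi d = psi a]. *)
  apply/coarse_compE => d da; apply: val_inj; apply/funext => n.
  apply: etrans (part_g a _ d n (uM a)) _; rewrite /single; case: eqP => // dE.
  by move: da; rewrite dE raddfD (cK n) addr0 eqxx.
have g_pred : (g : coarsen psi gR M -> coarsen psi gR N') \in
    hom_pred (coarsen psi gR M) (coarsen psi gR N').
  exact: (@family_sum_in _ _ _ _ 0).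
(* The preimage [w] has underlying map [g], so [g] is a finite sum of maps [u d] homogeneous for the
   [G]-gradings. *)
have [w /(congr1 (@hom_fun _ _ _ _ _)) /= wg] := hpsi_surj (HomSort g_pred).
have /family_sumP[u [uh fu gE]] := hom_funP (w : GHom M N').
rewrite wg in gE.
(* For [x] of degree [a], the part of [g x] of degree [a + c n] is [u (c n) x], and its [n]-th entry
   is the component of degree [b n] of [f] at [x]. If [u (c n)] vanished, that component would
   vanish on all homogeneous elements, hence everywhere. *)
have uc n : u (c n) != 0.
  apply/eqP => u0; move/eqP: (fb n); apply; apply/funext => x.
  have [t ut xt] := fin_suppP (part_fin (mod_grading M) x).
  rewrite (part_sum (mod_grading M) x) (fsumT_seq ut xt) degree_component_sum.
  rewrite big1 // => a _; have xa := part_in (mod_grading M) x a.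
  have := part_g _ _ (a + c n) n xa; rewrite /single eqxx => <-.
  by rewrite gE (hom_part _ uh fu xa) u0.
(* Pulled back along the injective [c], the finite support of [u] would contain every natural
   number. *)
apply: infinite_nat; apply: sub_finite_set (fin_supp_comp cI fu) => n _ /=.
exact: uc.
Qed.

End InfiniteKernel.

(** An element of the [H]-graded Hom is a finite sum of linear maps, hence itself a linear map from
    [M] to [N]. By assumption it lies in the [G]-graded Hom, and there it is its own preimage. *)
Lemma hpsi_iso_of_linear_hom_pred (G H : zmodType) (psi : {additive G -> H})
    (R : comPzRingType) (gR : grRing G R) (M : grMod gR) :
  (forall (N : grMod gR) (f : {linear M -> N}), (f : M -> N) \in hom_pred M N) ->
  is_functor_iso (hpsi psi M).
Proof.
move=> Mhom; apply: bij_functor_iso => [N|N y]; first exact: hpsi_inj.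
suff yP : (hom_fun y : M -> N) \in hom_pred M N.
  by exists (HomSort yP); apply: val_inj.
have yl : linear (hom_fun y : M -> N).
  have /family_sumP[u [uh fu ->]] := hom_funP y; have [s us u0] := fin_suppP fu.
  move=> k x z; rewrite (fsumT_seq us u0) !fct_sumE scaler_sumr -big_split.
  apply: eq_bigr => h _; have /hom_compP[ul _] := uh h; exact: ul.
exact: (Mhom N (HB.pack (hom_fun y : M -> N) (GRing.isLinear.Build R M N *:%R _ yl))).
Qed.

Theorem mainTheorem3 (G : zmodType) (R : comPzRingType) (gR : grRing G R)
    (M : grMod gR) :
  (exists F : zmodClosed G,
      infinite_set [set g | g \in F] /\
      is_functor_iso (hpsi (quot_proj F) M)) ->
  (forall (H : zmodType) (psi : {additive G -> H}),
      (forall h : H, exists g : G, psi g = h) ->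
      is_functor_iso (hpsi psi M)) /\
  is_functor_iso (hpsi (to_trivial G) M).
Proof.
move=> [F [Finf /functor_iso_surj surj]].
(* [F] lies in the kernel of its projection, so that kernel is infinite. *)
have kerF : infinite_set [set g | quot_proj F g = 0].
  apply: sub_infinite_set Finf => g /= gF.
  by rewrite -(raddf0 (quot_proj F)); apply/eqP; rewrite -Quotient.idealrBE subr0.
have Mhom := linear_hom_pred kerF surj.
by split=> [H psi _|]; apply: hpsi_iso_of_linear_hom_pred.
Qed.
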